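(* Let $p$ be a prime and let $R=\mathbb{Z}_{2p}$. Let $d\in\{2,\dots,p-1\}$, let $\ell=\gcd(d-1,p-1)$, and let $f:R\to R$ be the map $x\mapsto x^d$. Then $$\Lambda_f=\left\{2p,\ \frac{2p\ell}{p-1},\ 0\right\},$$ and the code $C_{x^d}$ has (homogeneous) weight enumerator $$1+\frac{(p-1)^2}{\ell}X^{2p\frac{p-1-\ell}{p-1}}+\left(2p^2-\frac{(p-1)^2}{\ell}-1\right)X^{2p}.$$
   Context: $\mathbb{Z}_{m}$ denotes the ring of integers modulo $m$. A generating character of a finite commutative Frobenius ring $R$ is an additive character $\chi:R\to\mathbb{C}^\times$ such that every additive character of $R$ has the form $x\mapsto\chi(rx)$ for some $r\in R$. Fix a generating character $\chi$ of $R$. For $f:R\to R$ and $\alpha,\beta\in R$ define $$W^{f}(\alpha,\beta)=\frac{1}{|R^\times|}\sum_{u\in R^\times}\sum_{x\in R}\chi\big(u(\alpha x+\beta f(x))\big),\qquad \Lambda_{f}=\{W^{f}(\alpha,\beta):\alpha,\beta\in R\}.$$ The code $C_f$ (written $C_{x^d}$ when $f(x)=x^d$) is the set of functions $\{c^f_{\alpha,\beta}:R\to R,\ x\mapsto \alpha x+\beta f(x)\ :\ \alpha,\beta\in R\}$. The normalized homogeneous weight on $R$ is $w(x)=1-\frac{1}{|R^\times|}\sum_{u\in R^\times}\chi(xu)$, extended to functions $g:R\to R$ by $w(g)=\sum_{x\in R}w(g(x))$. The weight enumerator of a code $C$ is $\sum_{v}A_vX^v$, where $v$ runs over the distinct weights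 of elements of $C$ and $A_v=|\{c\in C:w(c)=v\}|$ (a formal expression with rational exponents). *)

(* Defs.v *)
From HB Require Import structures.
From mathcomp Require Import all_boot all_order all_algebra.
From mathcomp Require Import finmap monalg.
From mathcomp Require Import reals complex.

Set Implicit Arguments.
Unset Strict Implicit.
Unset Printing Implicit Defensive.

Import GRing.Theory.
Local Open Scope ring_scope.

(* For K : realType, K[i] is the field of complex numbers. *)

Section FrobeniusCodes.

Variables (K : realType) (R : finComUnitRingType).

Definition additive_character (chi : R -> K[i]) : Prop :=
  (forall x, chi x != 0) /\ {morph chi : x y / x + y >-> x * y}.

(* A finite commutative ring is Frobenius exactly when it has a generating
   character, so no separate Frobenius hypothesis on R is carried around. *)
Definition generating_character (chi : R -> K[i]) : Prop :=
  additive_character chi /\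
  forall psi : R -> K[i], additive_character psi ->
    exists r : R, forall x, psi x = chi (r * x).

Definition ring_units : {set R} := [set u : R | u \is a GRing.unit].

Definition W (chi : R -> K[i]) (f : R -> R) (a b : R) : K[i] :=
  #|ring_units|%:R^-1 *
    \sum_(u in ring_units) \sum_(x : R) chi (u * (a * x + b * f x)).

Definition Lambda (chi : R -> K[i]) (f : R -> R) : {fset K[i]} :=
  [fset W chi f a b | a : R, b : R]%fset.

(* The code is a set of functions: distinct pairs (a, b) may give the same
   codeword, which is then counted once. *)
Definition code (f : R -> R) : {set {ffun R -> R}} :=
  [set [ffun x => a * x + b * f x] | a : R, b : R].

Definition hweight (chi : R -> K[i]) (x : R) : K[i] :=
  1 - #|ring_units|%:R^-1 * \sum_(u in ring_units) chi (x * u).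

Definition hweight_fun (chi : R -> K[i]) (g : {ffun R -> R}) : K[i] :=
  \sum_(x : R) hweight chi (g x).

End FrobeniusCodes.

(* Formal finite sums of c X^v with c in rat. The exponents v range over K[i],
   the type in which the homogeneous weight takes its values. *)
Definition Xpow (K : realType) (v : K[i]) : {malg rat[K[i]]} := << 1 *g v >>.

Definition weight_enumerator (K : realType) (R : finComUnitRingType)
    (chi : R -> K[i]) (C : {set {ffun R -> R}}) : {malg rat[K[i]]} :=
  \sum_(v <- [fset hweight_fun chi c | c in C]%fset)
    #|[set c in C | hweight_fun chi c == v]|%:R *: Xpow v.

(* Main.v *)
Require Import Defs.
From HB Require Import structures.
From mathcomp Require Import all_boot all_order all_algebra.
From mathcomp Require Import finmap monalg.
From mathcomp Require Import reals complex.
From mathcomp Require Import cyclic finfield ring.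

Set Implicit Arguments.
Unset Strict Implicit.
Unset Printing Implicit Defensive.

Import GRing.Theory Num.Theory.
Local Open Scope ring_scope.

(** By the Chinese remainder theorem Z_2p is the product of F_2 and F_p, and
    chi is accordingly the product of the sign character of F_2 and a nontrivial
    character of F_p (the factors are nontrivial because every character of
    Z_2p, in particular one living on a single factor, is a multiple of chi).
    The units are the pairs (1, v) with v nonzero, so averaging chi (u * y) over
    the units leaves the sign of the F_2 component of y, times 1 if the F_p
    component vanishes and - 1 / (p - 1) otherwise ([unit_average_product]).

    On F_2 the map x -> x ^ d is the identity.  Hence summing the average at
    a x + b x ^ d over all x gives 0 when a and b have different F_2 components,
    and otherwise 2 p N / (p - 1), where N is the number of nonzero zeros of
    a x + b x ^ d in F_p ([W_product]).

    For (a, b) nonzero in F_p the nonzero zeros form either the empty set or a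
    coset of the group of (d - 1)-th roots of unity, which has order l
    ([card_nonzero_zeros]); this determines Lambda.  As each nonzero x and each
    b determine a unique a, the numbers N add up to (p - 1) p, of which the pair
    (0, 0) contributes p - 1; so exactly (p - 1) ^ 2 / l pairs have N = l
    ([card_nontrivial_pairs]).

    A codeword determines, and is determined by, the sum of the F_2 components
    of a and b together with their F_p components ([codeword_inj],
    [code_product]); its weight is 2 p - W.  Grouping the 2 p ^ 2 codewords by
    that data gives the weight enumerator.

    Only the last step mentions Z_2p: the computation is made for any ring that
    is a product of F_2 and a finite field with q elements, for 1 < d < q. *)

(** * Zeros of a x + b x ^ d in a finite field *)

Section Zeros.

Variable F : finFieldType.
Implicit Types (a b x : F) (d m : nat).

Let card_gt0 : (0 < #|F|)%N.
Proof. exact: ltnW (finNzRing_gt1 F). Qed.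

Lemma expf_card_pred x : x != 0 -> x ^+ #|F|.-1 = 1.
Proof.
by move=> x0; apply: (mulfI x0); rewrite -exprS prednK ?mulr1 ?expf_card.
Qed.

Lemma exists_prim_root : exists z : F, #|F|.-1.-primitive_root z.
Proof.
have F1 : (0 < #|F|.-1)%N by rewrite -ltnS prednK ?finNzRing_gt1.
have /hasP[z _ zP] : has #|F|.-1.-primitive_root (enum [pred x : F | x != 0]).
  apply: has_prim_root => //; last 2 first.
  - exact: enum_uniq.
  - by rewrite -cardE -(cardC1 (0 : F)); apply/eq_leq/eq_card.
  apply/allP => x; rewrite mem_enum inE => x0.
  exact/unity_rootP/expf_card_pred.
by exists z.
Qed.

(** In the cyclic group of order n of nonzero elements, x ^ m = 1 amounts to
    x ^ gcd(m, n) = 1 by Bezout, and the solutions of the latter are the powers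
    of a primitive root of order gcd(m, n). *)
Lemma card_power_eq1 m : (0 < m)%N ->
  #|[set x : F | x ^+ m == 1]| = gcdn m #|F|.-1.
Proof.
move=> m0; have [z zP] := exists_prim_root.
set n := #|F|.-1 in zP *; set l := gcdn m n.
have wP : l.-primitive_root (z ^+ (n %/ l)).
  by rewrite dvdn_prim_root ?dvdn_gcdr.
set w := z ^+ _ in wP.
rewrite -[RHS]card_ord -(card_imset (f := fun i : 'I_l => w ^+ i)); last first.
  move=> i j /eqP; rewrite (eq_prim_root_expr wP) !modn_small //.
  by move/eqP/val_inj.
apply/eq_card => x; rewrite inE; apply/eqP/imsetP => [xm|[i _ ->]]; last first.
  apply/eqP; rewrite exprAC -[m](divnK (dvdn_gcdl m n)) mulnC exprM.
  by rewrite (prim_expr_order wP) !expr1n.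
have x0 : x != 0.
  apply/eqP => x0; move/eqP: xm.
  by rewrite x0 expr0n gtn_eqF // eq_sym oner_eq0.
have xn : x ^+ n = 1 by apply: expf_card_pred.
have xl : x ^+ l = 1.
  (* Bezout: u * m = v * n + l *)
  have [u v uv _] := egcdnP n m0.
  have : x ^+ (u * m) = 1 by rewrite mulnC exprM xm expr1n.
  by rewrite uv exprD mulnC exprM xn expr1n mul1r.
by have [i ->] := prim_rootP wP xl; exists i.
Qed.

Definition nonzero_zeros d a b : {set F} :=
  [set x | (x != 0) && (a * x + b * x ^+ d == 0)].

Lemma card_nonzero_zeros00 d : #|nonzero_zeros d 0 0| = #|F|.-1.
Proof.
rewrite -(cardC1 (0 : F)); apply/eq_card => x.
by rewrite !inE !mul0r addr0 eqxx andbT.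
Qed.

(** If x0 is a nonzero zero then a = - b x0 ^ (d - 1) with b nonzero, so the
    other nonzero zeros x are those with (x / x0) ^ (d - 1) = 1. *)
Lemma nonzero_zeros_ratio d x0 a b : (1 < d)%N -> (a, b) != (0, 0) ->
  x0 \in nonzero_zeros d a b ->
  nonzero_zeros d a b = [set x0 * u | u in [set u | u ^+ d.-1 == 1]].
Proof.
case: d => [|d]//= d1 ab; rewrite inE => /andP[x0N0 /eqP x0P].
have aE : a = - b * x0 ^+ d.
  apply: (mulIf x0N0); apply/eqP.
  by rewrite -subr_eq0 mulNr mulNr opprK -mulrA -exprSr x0P.
have bN0 : b != 0 by apply: contraNneq ab => b0; rewrite aE b0 oppr0 mul0r.
apply/setP => x; rewrite !inE; apply/andP/imsetP.
  case=> xN0; rewrite aE exprSr mulrA -mulrDl mulNr addrC -mulrBr !mulf_eq0.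
  rewrite (negPf bN0) (negPf xN0) orbF /= subr_eq0 => /eqP xd.
  exists (x / x0); last by rewrite mulrCA divff // mulr1.
  by rewrite inE expr_div_n xd divff // expf_neq0.
case=> u; rewrite inE => /eqP u1 ->; split.
  rewrite mulf_neq0 //; apply/eqP => u0; move/eqP: u1.
  by rewrite u0 expr0n gtn_eqF // eq_sym oner_eq0.
rewrite exprMn exprSr [u ^+ _]exprSr u1 mul1r !mulrA.
by rewrite -mulrDl -mulrA -exprSr x0P mul0r.
Qed.

Lemma card_nonzero_zeros d a b : (1 < d)%N -> (a, b) != (0, 0) ->
  #|nonzero_zeros d a b| =
    if nonzero_zeros d a b == set0 then 0 else gcdn d.-1 #|F|.-1.
Proof.
move=> d1 ab; have [->|[x0 x0P]] := set_0Vmem (nonzero_zeros d a b).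
  by rewrite eqxx cards0.
have -> : (nonzero_zeros d a b == set0) = false.
  by apply/eqP => Z0; rewrite Z0 inE in x0P.
rewrite (nonzero_zeros_ratio d1 ab x0P) card_imset ?card_power_eq1 //.
  by rewrite -ltnS (ltn_predK d1).
by apply: mulfI; move: x0P; rewrite inE => /andP[].
Qed.

(** Counting triples (a, b, x) the other way: each nonzero x and each b admit
    exactly one a with a x + b x ^ d = 0. *)
Lemma sum_card_nonzero_zeros d : (1 < d)%N ->
  (\sum_(ab : F * F) #|nonzero_zeros d ab.1 ab.2| = #|F|.-1 * #|F|)%N.
Proof.
move=> d1.
transitivity (\sum_(x : F | (x != 0)%R)
                 \sum_(ab : F * F | (ab.1 == - (ab.2 * x ^+ d.-1))%R) 1)%N.
  under eq_bigr do rewrite -sum1_card.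
  rewrite (exchange_big_dep (fun x => x != 0)) /=; last first.
    by move=> ab x _; rewrite inE => /andP[].
  apply: eq_bigr => x xN0; apply: eq_bigl => -[a b] /=.
  rewrite inE xN0 /= -{1}(ltn_predK d1) exprSr mulrA -mulrDl.
  rewrite mulf_eq0 (negPf xN0) orbF.
  by rewrite addr_eq0.
(* for fixed x, the solutions (a, b) are parametrized by b *)
rewrite -(cardC1 (0 : F)) -sum_nat_const; apply: eq_bigr => x _.
rewrite sum1_card -[RHS](card_imset (f := fun b => (- (b * x ^+ d.-1), b))).
  apply/eq_card => -[a b]; rewrite unfold_in /=.
  by apply/eqP/imsetP => [->|[c _ [-> ->]]//]; exists b.
by move=> b c [].
Qed.

(** Stated without division; outside (0, 0) every nonempty set of nonzero zeros
    has the same cardinality, so the total count determines how many there are. *)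
Lemma card_nontrivial_pairs d : (1 < d)%N ->
  (#|[set ab : F * F |
        (ab != (0%R, 0%R)) && (nonzero_zeros d ab.1 ab.2 != set0)]|
     * gcdn d.-1 #|F|.-1 = #|F|.-1 ^ 2)%N.
Proof.
move=> d1; have := sum_card_nonzero_zeros d1.
rewrite (bigD1 (0, 0)) //= card_nonzero_zeros00 => sumE.
have {sumE} : (\sum_(ab : F * F | ab != (0%R, 0%R)) #|nonzero_zeros d ab.1 ab.2|
    = #|F|.-1 ^ 2)%N.
  apply/(@addnI #|F|.-1); rewrite sumE -[X in (_ + X)%N]/(#|F|.-1 * #|F|.-1)%N.
  by rewrite -mulnS prednK.
move=> <-; rewrite -sum_nat_const [LHS]big_mkcond [RHS]big_mkcond /=.
apply: eq_bigr => -[a b] _; rewrite inE /=.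
by case: eqP => //= /eqP ab; rewrite (card_nonzero_zeros d1 ab); case: eqP.
Qed.

End Zeros.

(** * Averages over units, weights and weight enumerators *)

Section Characters.

Variables (K : realType) (R : finComUnitRingType) (chi : R -> K[i]).
Hypothesis chi_char : additive_character chi.

Lemma character0 : chi 0 = 1.
Proof.
have [chiN0 chiD] := chi_char.
by apply: (mulfI (chiN0 0)); rewrite -chiD addr0 mulr1.
Qed.

Definition unit_average (y : R) : K[i] :=
  #|ring_units R|%:R^-1 * \sum_(u in ring_units R) chi (u * y).

Lemma W_unit_average (f : R -> R) a b :
  W chi f a b = \sum_x unit_average (a * x + b * f x).
Proof. by rewrite /W exchange_big mulr_sumr. Qed.

Lemma hweight_fun_W (f : R -> R) a b :
  hweight_fun chi [ffun x => a * x + b * f x] = #|R|%:R - W chi f a b.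
Proof.
rewrite W_unit_average /hweight_fun -sum1_card natr_sum -sumrB.
apply: eq_bigr => x _; rewrite ffunE /hweight /unit_average.
by congr (_ - _ * _); apply: eq_bigr => u _; rewrite mulrC.
Qed.

End Characters.

(** Grouping by weight is undone: summed codeword by codeword, equal exponents
    merge by themselves. *)
Lemma weight_enumeratorE (K : realType) (R : finComUnitRingType)
    (chi : R -> K[i]) (C : {set {ffun R -> R}}) :
  weight_enumerator chi C = \sum_(c in C) Xpow (hweight_fun chi c).
Proof.
rewrite /weight_enumerator; set S := [fset _ | _ in _]%fset.
rewrite [RHS](eq_bigr (fun c =>
    \sum_(v <- S | hweight_fun chi c == v) Xpow v)); last first.
  move=> c cC; set w := hweight_fun chi c.
  rewrite -big_filter (_ : filter _ _ = [:: w]) ?big_seq1 //.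
  rewrite (eq_filter (a2 := pred1 w)); last by move=> v; rewrite /= eq_sym.
  by rewrite filter_pred1_uniq ?fset_uniq //; apply/imfsetP; exists c.
rewrite (exchange_big_dep predT) //=; apply: eq_bigr => v _.
rewrite (eq_bigl (mem [set c in C | hweight_fun chi c == v])); last first.
  by move=> c; rewrite !inE.
by rewrite sumr_const scaler_nat.
Qed.

(** * Rings that are a product of F_2 and a finite field *)

Lemma F2_cases (i : 'F_2) : i = 0 \/ i = 1.
Proof. by case: i => [[|[|//]]] ?; [left|right]; apply: val_inj. Qed.

Lemma sum_F2 (V : nmodType) (f : 'F_2 -> V) : \sum_i f i = f 0 + f 1.
Proof.
rewrite (bigD1 0) //= (bigD1 1) //= big1 ?addr0 // => i.
by case: (F2_cases i) => ->; rewrite eqxx ?andbF.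
Qed.

(** The product decomposition is given by the two projections [s] and [t] and
    the inverse [g] of the pairing, so that the results apply to Z_2p without
    transporting chi along an isomorphism.  That chi is generating enters as its
    nontriviality on each factor. *)
Section ProductRing.

Variables (K : realType) (R : finComUnitRingType) (F : finFieldType).
Variables (s : {rmorphism R -> 'F_2}) (t : {rmorphism R -> F}).
Variable g : 'F_2 * F -> R.
Hypothesis stK : cancel (fun x => (s x, t x)) g.
Hypothesis gK : cancel g (fun x => (s x, t x)).

Variable chi : R -> K[i].
Hypothesis chi_char : additive_character chi.
Hypothesis chi_s : exists2 y, t y = 0 & chi y != 1.
Hypothesis chi_t : exists2 y, s y = 0 & chi y != 1.

Variable d : nat.
Hypothesis d_range : (1 < d < #|F|)%N.

Let q := #|F|.
Let f (x : R) := x ^+ d.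

Let sg k : s (g k) = k.1. Proof. by have := gK k => /(congr1 fst). Qed.
Let tg k : t (g k) = k.2. Proof. by have := gK k => /(congr1 snd). Qed.
Let st_inj x y : s x = s y -> t x = t y -> x = y.
Proof. by move=> sxy txy; rewrite -[x]stK -[y]stK sxy txy. Qed.

Let s0 : s 0 = 0. Proof. exact: rmorph0. Qed.
Let t0 : t 0 = 0. Proof. exact: rmorph0. Qed.
Let g0 : g (0, 0) = 0. Proof. by apply: st_inj; rewrite ?sg ?tg. Qed.

Lemma card_product : #|R| = (2 * q)%N.
Proof.
by rewrite (bij_eq_card (Bijective stK gK)) card_prod card_Fp.
Qed.

Let q_gt1 : (1 < q)%N. Proof. exact: finNzRing_gt1. Qed.
Let qK : (q.-1%:R = q%:R - 1 :> K[i]).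
Proof. by rewrite -subn1 natrB // ltnW. Qed.

Let q1N0 : (q%:R - 1 : K[i]) != 0.
Proof. by rewrite -qK pnatr_eq0 -lt0n -ltnS prednK // ltnW. Qed.

Lemma unit_product u : (u \in ring_units R) = (s u != 0) && (t u != 0).
Proof.
rewrite inE; apply/idP/andP => [uU|[su tu]].
  by rewrite -!unitfE !rmorph_unit.
apply/unitrP; exists (g ((s u)^-1, (t u)^-1)).
by split; apply: st_inj; rewrite rmorphM ?sg ?tg rmorph1 ?mulVf ?mulfV.
Qed.

Lemma sum_units (h : R -> K[i]) :
  \sum_(u in ring_units R) h u = \sum_(v : F | v != 0) h (g (1, v)).
Proof.
rewrite (reindex (fun v => g (1, v))) /=; last first.
  exists t => [v _|x]; first by rewrite tg.
  rewrite unit_product => /andP[sx _]; apply: st_inj; rewrite ?sg ?tg //=.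
  by case: (F2_cases (s x)) sx => ->.
by apply: eq_bigl => v; rewrite unit_product sg tg.
Qed.

Lemma card_units : #|ring_units R| = q.-1.
Proof.
apply/eqP; rewrite -(@eqr_nat K[i]) -sumr_const sum_units sumr_const.
by rewrite cardC1.
Qed.

(** On the F_2 factor chi takes a value of square 1 at the nonzero element, and
    this value is not 1 because chi is nontrivial there. *)
Lemma character_split y :
  chi y = (-1) ^+ (s y != 0) * chi (g (0, t y)).
Proof.
have [_ chiD] := chi_char.
have {1}-> : y = g (s y, 0) + g (0, t y).
  by apply: st_inj; rewrite rmorphD ?sg ?tg /= ?addr0 ?add0r.
rewrite chiD; congr (_ * _); case: (F2_cases (s y)) => ->;
  rewrite ?eqxx ?oner_eq0 /=.
  by rewrite expr0 -(character0 chi_char) g0.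
set e := g _; have e2 : chi e ^+ 2 == 1.
  rewrite expr2 -chiD -(character0 chi_char); apply/eqP; congr chi.
  by apply: st_inj; rewrite rmorphD ?sg ?tg ?s0 ?t0 ?addr0 //; apply: val_inj.
move: e2; rewrite sqrf_eq1 expr1 => /orP[] /eqP // e1.
have [z tz] := chi_s; suff -> : chi z = 1 by rewrite eqxx.
case: (F2_cases (s z)) => sz; [rewrite -(character0 chi_char)|rewrite -e1];
  by congr chi; apply: st_inj; rewrite ?sg ?tg ?s0 ?t0.
Qed.

Lemma sum_character_F : \sum_(v : F) chi (g (0, v)) = 0.
Proof.
have [_ chiD] := chi_char; have [z sz chiz] := chi_t.
(* translation by t z permutes the terms and multiplies each by chi z *)
set S := \sum_v _; have : chi z * S = S.
  rewrite [RHS](reindex_inj (addrI (t z))) mulr_sumr; apply: eq_bigr => v _.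
  rewrite -chiD; congr chi.
  by apply: st_inj; rewrite rmorphD ?sg ?tg //= sz addr0.
move/eqP; rewrite -subr_eq0 -[X in _ - X]mul1r -mulrBl mulf_eq0 subr_eq0.
by rewrite (negPf chiz) => /eqP.
Qed.

(** The sum over v of chi (g (0, v * t y)) is a full character sum over F, hence
    0, with the term v = 0 removed. *)
Lemma unit_average_product y :
  unit_average chi y =
    (-1) ^+ (s y != 0) * (if t y == 0 then 1 else - (q%:R - 1)^-1).
Proof.
rewrite /unit_average sum_units card_units.
under eq_bigr => v _ do rewrite character_split !rmorphM sg tg mul1r.
rewrite -mulr_sumr mulrCA; congr (_ * _); rewrite qK.
case: eqP => [->|/eqP ty].
  under eq_bigr => v _ do rewrite mulr0.
  by rewrite g0 character0 // sumr_const cardC1 -/q qK mulVf.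
have := sum_character_F; rewrite (reindex_inj (mulIf ty)) (bigD1 0) //= mul0r.
rewrite g0 character0 // => /eqP.
by rewrite addrC addr_eq0 => /eqP ->; rewrite mulrN1.
Qed.

(** The zero v = 0 contributes 1 and each of the other N zeros raises its term
    by q / (q - 1) over the value - 1 / (q - 1); the constant parts cancel. *)
Lemma sum_zero_indicator a b :
  \sum_(v : F) (if a * v + b * v ^+ d == 0 then 1 else - (q%:R - 1)^-1) =
    q%:R * #|nonzero_zeros d a b|%:R / (q%:R - 1) :> K[i].
Proof.
have d0 : (0 < d)%N by case/andP: d_range => /ltnW.
rewrite (bigD1 0) //= expr0n gtn_eqF // !mulr0 addr0 eqxx.
set c := (q%:R - 1)^-1; rewrite (eq_bigr (fun v =>
    (if v \in nonzero_zeros d a b then 1 + c else 0) - c)); last first.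
  by move=> v vN0; rewrite inE vN0 /=; case: ifP => _; rewrite ?addrK ?sub0r.
rewrite sumrB sumr_const cardC1 -big_mkcondr /=.
rewrite (eq_bigl (mem (nonzero_zeros d a b))); last first.
  by move=> v; rewrite !inE andbA andbb.
rewrite sumr_const -/q -[c *+ _]mulr_natr -[(1 + c) *+ _]mulr_natr qK /c.
by field; exact: q1N0.
Qed.

Lemma W_product a b :
  W chi f a b = if s a == s b then
    2 * q%:R * #|nonzero_zeros d (t a) (t b)|%:R / (q%:R - 1) else 0.
Proof.
have d0 : (0 < d)%N by case/andP: d_range => /ltnW.
pose H : K[i] := \sum_(v : F)
  (if t a * v + t b * v ^+ d == 0 then 1 else - (q%:R - 1)^-1).
transitivity (\sum_(i : 'F_2) (-1) ^+ ((s a + s b) * i != 0) * H).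
  rewrite W_unit_average (reindex g) /=; last by exists (fun x => (s x, t x)).
  under [RHS]eq_bigr do rewrite mulr_sumr.
  rewrite pair_bigA; apply: eq_bigr => -[i v] _ /=.
  rewrite unit_average_product !rmorphD !rmorphM !rmorphXn sg tg /=.
  suff -> : i ^+ d = i by rewrite -mulrDl.
  by case: (F2_cases i) => ->; rewrite ?expr1n // expr0n gtn_eqF.
rewrite sum_F2 mulr0 mulr1 eqxx expr0 mul1r.
have -> : (s a + s b != 0) = (s a != s b).
  by case: (F2_cases (s a)) => ->; case: (F2_cases (s b)) => ->.
case: eqP => _ /=; last by rewrite expr1 mulN1r subrr.
rewrite expr0 mul1r /H sum_zero_indicator; ring.
Qed.

Let l := gcdn d.-1 #|F|.-1.

Let l_lt : (l < q.-1)%N.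
Proof.
case/andP: d_range => d1 dq; apply: (@leq_ltn_trans d.-1).
  by rewrite dvdn_leq ?dvdn_gcdl // -ltnS (ltn_predK d1).
by rewrite -ltnS (ltn_predK d1) prednK // ltnW.
Qed.

Let l_gt0 : (0 < l)%N.
Proof.
by case/andP: d_range => d1 _; rewrite gcdn_gt0 -ltnS (ltn_predK d1) d1.
Qed.

Let W1 : K[i] := 2 * q%:R * l%:R / (q%:R - 1).

Lemma W_product_cases a b :
  W chi f a b =
    if s a == s b then
      if (t a, t b) == (0, 0) then 2 * q%:R
      else if nonzero_zeros d (t a) (t b) == set0 then 0 else W1
    else 0.
Proof.
rewrite W_product; case: (s a == s b) => //; case: eqP => [[-> ->]|/eqP tab].
  by rewrite card_nonzero_zeros00 -/q qK mulfK.
rewrite card_nonzero_zeros //; last by case/andP: d_range.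
by case: (_ == set0); rewrite // mulr0 mul0r.
Qed.

Lemma Lambda_product : Lambda chi f = [fset 2 * q%:R; W1; 0]%fset.
Proof.
apply/fsetP => w; rewrite !inE; apply/imfset2P/idP => /= [[a _ [b _ ->]]|].
  rewrite W_product_cases.
  case: ifP => _; rewrite ?eqxx ?orbT //.
  by do 2?case: ifP => _; rewrite ?eqxx ?orbT.
case/orP => [/orP[]|] /eqP ->.
- by exists 0 => //; exists 0 => //; rewrite W_product_cases !rmorph0 !eqxx.
(* - x + x ^ d has the nonzero zero 1, and -1 = 1 in F_2 *)
- exists (-1) => //; exists 1 => //.
  rewrite W_product_cases !rmorphN !rmorph1.
  have -> : (-1 == 1 :> 'F_2) by [].
  rewrite xpair_eqE oner_eq0 andbF.
  case: eqP => // Z0; have : (1 : F) \in nonzero_zeros d (-1) 1.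
    by rewrite inE expr1n !mulr1 addNr oner_eq0 eqxx.
  by rewrite Z0 inE.
- by exists 1 => //; exists 0 => //; rewrite W_product_cases rmorph0 rmorph1.
Qed.

(** A parametrization of the code without repetitions: the F_2 components of
    a and b matter only through their sum. *)
Definition codeword (k : 'F_2 * (F * F)) : {ffun R -> R} :=
  [ffun x => g (k.1, k.2.1) * x + g (0, k.2.2) * x ^+ d].

(** Two equal codewords give an F-component a x + b x ^ d vanishing on all of F;
    a nonzero pair (a, b) has at most l + 1 zeros, and l + 1 < q. *)
Lemma codeword_inj : injective codeword.
Proof.
have [d1 _] := andP d_range.
move=> [i [a b]] [j [a' b']] /ffunP cE.
have {}cE v : i = j /\ a * v + b * v ^+ d = a' * v + b' * v ^+ d.
  (* evaluate at the element with components 1 and v *)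
  have := cE (g (1, v)); rewrite !ffunE /= => E; split.
    move: (congr1 s E); rewrite !rmorphD !rmorphM !rmorphXn !sg /=.
    by rewrite !mulr1 !mul0r !addr0.
  by move: (congr1 t E); rewrite !rmorphD !rmorphM !rmorphXn !tg.
have [-> _] := cE 0; suff [-> ->] : a = a' /\ b = b' by [].
have Zall : #|nonzero_zeros d (a - a') (b - b')| = q.-1.
  rewrite -(cardC1 (0 : F)); apply/eq_card => v; rewrite !inE.
  have [_ E] := cE v; rewrite !mulrBl addrACA -opprD E subrr eqxx andbT //.
have [E|ab] := eqVneq (a - a', b - b') (0, 0).
  by case: E => /eqP + /eqP; rewrite !subr_eq0 => /eqP -> /eqP ->.
move: Zall; rewrite card_nonzero_zeros // -/l => Zall.
by move: l_lt; rewrite -Zall; case: ifP; rewrite ?ltn0 ?ltnn.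
Qed.

(** In the F_2 component a x + b x ^ d = (a + b) x, so the F_2 component of b can
    be taken to be 0. *)
Lemma code_product : code f = [set codeword k | k in setT].
Proof.
apply/setP => c; apply/imset2P/imsetP; last first.
  case=> -[i [a b]] _ ->.
  by exists (g (i, a)) (g (0, b)).
case=> a b _ _ ->; exists (s a + s b, (t a, t b)) => //.
apply/ffunP => x; rewrite !ffunE /f /=.
apply: st_inj; rewrite !rmorphD !rmorphM !rmorphXn ?sg ?tg //=.
have d0 : (0 < d)%N by case/andP: d_range => /ltnW.
case: (F2_cases (s x)) => ->;
  rewrite ?expr0n ?(gtn_eqF d0) ?expr1n ?mulr0 ?addr0 //.
by rewrite !mulr1 addr0.
Qed.

Let S := [set ab : F * F |
  (ab != (0, 0)) && (nonzero_zeros d ab.1 ab.2 != set0)].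

Lemma card_S : #|S|%:R = (q%:R - 1) ^+ 2 / l%:R :> rat.
Proof.
have d1 : (1 < d)%N by case/andP: d_range.
have lN0 : l%:R != 0 :> rat by rewrite pnatr_eq0 -lt0n.
have qKrat : q.-1%:R = q%:R - 1 :> rat by rewrite -subn1 natrB // ltnW.
apply: (mulIf lN0); rewrite divfK // -natrM card_nontrivial_pairs //.
by rewrite natrX qKrat.
Qed.

Lemma hweight_codeword k :
  hweight_fun chi (codeword k) = 2 * q%:R -
    (if k.1 == 0 then
       if k.2 == (0, 0) then 2 * q%:R else if k.2 \in S then W1 else 0
     else 0).
Proof.
case: k => i [a b]; rewrite (hweight_fun_W _ f) card_product natrM.
rewrite W_product_cases !sg !tg inE /=; case: (i == 0) => //; case: eqP => //= _.
by case: (_ == set0).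
Qed.

(** The q ^ 2 codewords with nonzero F_2 component all have weight 2 q; among
    the others, one has weight 0, those indexed by [S] have weight 2 q - W1, and
    the rest have weight 2 q. *)
Lemma weight_enumerator_product :
  weight_enumerator chi (code f) =
    Xpow 0
    + ((q%:R - 1) ^+ 2 / l%:R)
        *: Xpow (2 * q%:R * ((q%:R - 1 - l%:R) / (q%:R - 1)))
    + (2 * q%:R ^+ 2 - (q%:R - 1) ^+ 2 / l%:R - 1) *: Xpow (2 * q%:R).
Proof.
rewrite weight_enumeratorE code_product big_imset /=; last first.
  by move=> k k' _ _; apply: codeword_inj.
rewrite (eq_bigl predT) => [|k]; last by rewrite inE.
pose G i ab := Xpow (hweight_fun chi (codeword (i, ab))).
rewrite (eq_bigr (fun k => G k.1 k.2)); last by case.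
rewrite -pair_bigA /G /=.
rewrite sum_F2 addrC.
under eq_bigr => ab _ do rewrite hweight_codeword /= subr0.
rewrite sumr_const card_prod -/q.
have -> : 2 * q%:R * ((q%:R - 1 - l%:R) / (q%:R - 1)) = 2 * q%:R - W1.
  by rewrite /W1; field; exact: q1N0.
set X := Xpow (2 * q%:R); set Y := Xpow (_ - _).
rewrite (bigD1 (0, 0)) //= hweight_codeword /= eqxx subrr.
rewrite (eq_bigr (fun ab => (if ab \in S then Y - X else 0) + X)); last first.
  move=> ab ab0; rewrite hweight_codeword /= (negPf ab0).
  by case: (_ \in S); rewrite ?subrK // subr0 add0r.
rewrite big_split /= -big_mkcondr (eq_bigl (mem S)); last first.
  by move=> ab; rewrite !inE andbA andbb.
rewrite !sumr_const cardC1 card_prod -/q.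
rewrite -[(Y - X) *+ _]scaler_nat -[X *+ (q * q)]scaler_nat.
rewrite -[X *+ _.-1]scaler_nat card_S.
have -> : (q * q).-1%:R = q%:R ^+ 2 - 1 :> rat.
  by rewrite -subn1 natrB ?natrM // muln_gt0 !(ltnW q_gt1).
rewrite natrM -expr2; set A := _ / l%:R.
have -> : 2 * q%:R ^+ 2 - A - 1 = q%:R ^+ 2 - 1 + q%:R ^+ 2 - A by ring.
rewrite [in RHS]scalerBl [in RHS]scalerDl scalerBr [LHS]addrC.
rewrite -!addrA; congr (_ + (_ + _)).
by rewrite addrC -addrA.
Qed.

End ProductRing.

(** * The integers modulo 2 p *)

Section ZpReduction.

Variables m n : nat.
Hypotheses (m_gt1 : (1 < m)%N) (n_gt1 : (1 < n)%N) (mn : (m %| n)%N).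

(** The hypotheses are arguments so that the morphism instances can be found from
    the term: without them reduction is not a ring morphism. *)
Definition Zp_reduction of (1 < m)%N & (1 < n)%N & (m %| n)%N :=
  fun x : 'Z_n => (x : nat)%:R : 'Z_m.
Let red := Zp_reduction m_gt1 n_gt1 mn.

Lemma Zp_reduction_nat k : red k%:R = k%:R.
Proof.
rewrite /red /Zp_reduction val_Zp_nat // -(Zp_nat_mod m_gt1 (k %% n)).
by rewrite modn_dvdm // Zp_nat_mod.
Qed.

Lemma Zp_reduction_zmod_morphism : zmod_morphism red.
Proof.
have redD x y : red (x + y) = red x + red y.
  by rewrite -[x]natr_Zp -[y]natr_Zp -natrD !Zp_reduction_nat natrD.
by move=> x y; apply: (addIr (red y)); rewrite -redD !subrK.
Qed.

Lemma Zp_reduction_monoid_morphism : monoid_morphism red.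
Proof.
split=> [|x y]; first by rewrite (Zp_reduction_nat 1).
by rewrite -[x]natr_Zp -[y]natr_Zp -natrM !Zp_reduction_nat natrM.
Qed.

HB.instance Definition _ :=
  GRing.isZmodMorphism.Build 'Z_n 'Z_m red Zp_reduction_zmod_morphism.
HB.instance Definition _ :=
  GRing.isMonoidMorphism.Build 'Z_n 'Z_m red Zp_reduction_monoid_morphism.

End ZpReduction.

Lemma exists_nontrivial_root1 (C : numClosedFieldType) (p : nat) : prime p ->
  exists2 z : C, z ^+ p = 1 & z != 1.
Proof.
move=> p_prime; have p_gt1 := prime_gt1 p_prime.
have [|z /eqP pz] := closed_rootP (\poly_(i < p) (1 : C)) _.
  by rewrite size_poly_eq ?oner_eq0 // neq_ltn p_gt1 orbT.
rewrite horner_poly (eq_bigr _ (fun _ _ => mul1r _)) in pz.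
exists z; first by apply/eqP; rewrite -subr_eq0 subrX1 pz mulr0.
apply/eqP => z1; move/eqP: pz; rewrite z1.
under eq_bigr do rewrite expr1n.
by rewrite sumr_const card_ord pnatr_eq0 gtn_eqF // ltnW.
Qed.

(** Since [psi] is a multiple of [chi], the latter is nontrivial on the ideal
    generated by [x] as soon as some character is nontrivial at [x]. *)
Lemma generating_character_nontrivial (K : realType) (R : finComUnitRingType)
    (chi psi : R -> K[i]) (x : R) :
  generating_character chi -> additive_character psi -> psi x != 1 ->
  exists r, chi (r * x) != 1.
Proof. by move=> [_ gen] /gen[r psiE] x1; exists r; rewrite -psiE. Qed.

(** The character is z ^ (red x) for a complex p-th root of unity z <> 1. *)
Lemma Fp_character (K : realType) (R : finComUnitRingType) (p : nat)
    (red : {rmorphism R -> 'F_p}) : prime p ->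
  exists2 psi : R -> K[i], additive_character psi &
    forall x, red x = 1 -> psi x != 1.
Proof.
move=> p_prime; have [z zp z1] := exists_nontrivial_root1 K[i] p_prime.
exists (fun x => z ^+ red x); last first.
  by move=> x ->; rewrite /= modn_small ?expr1 // Fp_cast ?prime_gt1.
split=> [x|x y].
  apply: expf_neq0; apply/eqP => z0; move/eqP: zp.
  by rewrite z0 expr0n gtn_eqF ?prime_gt0 // eq_sym oner_eq0.
rewrite -exprD -[RHS](expr_mod _ zp) rmorphD /=; congr (_ ^+ _).
by rewrite [in X in (_ %% X)%N]Fp_cast.
Qed.

Theorem theorem5p3 (K : realType) (p : nat) (p_prime : prime p)
    (chi : 'Z_(2 * p) -> K[i]) (chi_gen : generating_character chi)
    (d : nat) (d_range : (2 <= d <= p - 1)%N) :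
  let l := gcdn (d - 1) (p - 1) in
  let f := fun x : 'Z_(2 * p) => x ^+ d in
  Lambda chi f =
    [fset 2 * p%:R; 2 * p%:R * l%:R / (p%:R - 1); 0]%fset
  /\
  weight_enumerator chi (code f) =
    Xpow 0
    + ((p%:R - 1) ^+ 2 / l%:R)
        *: Xpow (2 * p%:R * ((p%:R - 1 - l%:R) / (p%:R - 1)))
    + (2 * p%:R ^+ 2 - (p%:R - 1) ^+ 2 / l%:R - 1) *: Xpow (2 * p%:R).
Proof.
move=> l f.
have p_gt0 := prime_gt0 p_prime; have p_gt1 := prime_gt1 p_prime.
have p_gt2 : (2 < p)%N.
  by case/andP: d_range => d2 /(leq_trans d2); rewrite leq_subRL // addn2.
have p2_gt1 : (1 < 2 * p)%N by rewrite mul2n -addnn ltn_addl.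
have div_p : (pdiv p %| 2 * p)%N by rewrite pdiv_id // dvdn_mull.
have gt1_p : (1 < pdiv p)%N by rewrite pdiv_id.
pose s : {rmorphism 'Z_(2 * p) -> 'F_2} :=
  Zp_reduction (isT : (1 < 2)%N) p2_gt1 (dvdn_mulr p (dvdnn 2)).
pose t : {rmorphism 'Z_(2 * p) -> 'F_p} := Zp_reduction gt1_p p2_gt1 div_p.
have st_inj : injective (fun x => (s x, t x)).
  move=> x y [/(congr1 val) /= + /(congr1 val) /=].
  rewrite !val_Zp_nat // (pdiv_id p_prime) => /eqP sxy /eqP txy.
  have p_odd : coprime 2 p.
    by rewrite coprime2n; case: (even_prime p_prime) p_gt2 => // ->.
  have := chinese_remainder p_odd x y; rewrite sxy txy => /eqP.
  have lt2p (z : 'Z_(2 * p)) : (z < 2 * p)%N.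
    by have := ltn_ord z; rewrite [X in (_ < X)%N]Zp_cast.
  by rewrite !modn_small // => /val_inj.
have [g stK gK] : bijective (fun x => (s x, t x)).
  apply: inj_card_bij => //.
  by rewrite card_prod !card_Fp // card_ord Zp_cast.
have gs k : s (g k) = k.1 by have := gK k => /(congr1 fst).
have gt k : t (g k) = k.2 by have := gK k => /(congr1 snd).
have [chi_char _] := chi_gen.
have chi_s : exists2 y, t y = 0 & chi y != 1.
  have [psi psi_char psi1] := Fp_character K s isT.
  have [r rP] :=
    generating_character_nontrivial chi_gen psi_char (psi1 _ (gs (1, 0))).
  by exists (r * g (1, 0)); rewrite // rmorphM gt mulr0.
have chi_t : exists2 y, s y = 0 & chi y != 1.
  have [psi psi_char psi1] := Fp_character K t p_prime.
  have [r rP] :=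
    generating_character_nontrivial chi_gen psi_char (psi1 _ (gt (0, 1))).
  by exists (r * g (0, 1)); rewrite // rmorphM gs mulr0.
have dF : (1 < d < #|'F_p|)%N.
  by move: d_range; rewrite card_Fp // subn1 -[(d <= _)%N]ltnS prednK.
have := Lambda_product stK gK chi_char chi_s chi_t dF.
have := weight_enumerator_product stK gK chi_char chi_s chi_t dF.
by rewrite card_Fp // -!subn1.
Qed.
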